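(* Let $k\geq 2$ and $n\geq 1$ be integers, let $t_1,\dots,t_k$ be indeterminates, and work in the field $\mathbb{C}(t_1,\dots,t_k)$ of rational functions. Set $t_0=1$ and let $i=\sqrt{-1}$. Let $H_{k,n}=(h_{rs})_{1\le r,s\le n}$ be the $n\times n$ lower Hessenberg matrix with $$h_{rs}=\begin{cases} i^{\,r-s}\,\dfrac{t_{r-s+1}}{t_2^{\,r-s}} & \text{if } -1\leq r-s<k,\\[2mm] 0 & \text{otherwise.}\end{cases}$$ (Thus the superdiagonal entries are $-i t_2$, the diagonal entries are $t_1$, the subdiagonal entries are $i$, and the entries with $r-s=d$, $2\le d\le k-1$, are $i^{d}t_{d+1}/t_2^{d}$.) Then $$\operatorname{per}(H_{k,n})=F_{k,n+1}(t),$$ where $\operatorname{per}(A)=\sum_{\sigma\in S_n}\prod_{r=1}^n a_{r,\sigma(r)}$ denotes the permanent.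
   Context: The generalized Fibonacci polynomials $F_{k,n}(t)$, $t=(t_1,\dots,t_k)$, are defined by $F_{k,n}(t)=0$ for $n<1$, $F_{k,1}(t)=1$, $F_{k,2}(t)=t_1$, and $F_{k,n+1}(t)=t_1F_{k,n}(t)+t_2F_{k,n-1}(t)+\cdots+t_kF_{k,n-k+1}(t)$ for $n\ge 1$. *)

(* Defs.v *)
From HB Require Import structures.
From mathcomp Require Import all_boot all_order all_algebra all_fingroup.
From mathcomp Require Import fraction complex reals mpoly.

Set Implicit Arguments.
Unset Strict Implicit.
Unset Printing Implicit Defensive.

Import Order.TTheory GRing.Theory Num.Theory.
Local Open Scope ring_scope.

Definition permanent (A : pzSemiRingType) (n : nat) (M : 'M[A]_n) : A :=
  \sum_(s : 'S_n) \prod_(r < n) M r (s r).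

(* The indeterminates are numbered from 1 in the mathematics, from 0 in
   {mpoly A[k]}: t_j is 'X_(j-1) for 1 <= j <= k, and t_0 = 1.  The value 0 for
   j > k is a dummy. *)
Definition tvar (A : nzRingType) (k j : nat) : {mpoly A[k]} :=
  if j is j'.+1 then
    if insub j' is Some i then 'X_(i : 'I_k) else 0
  else 1.

(* [:: F_{k,n}; F_{k,n-1}; ...; F_{k,1}]; reading past the end yields 0, which
   is the convention F_{k,m} = 0 for m < 1. *)
Fixpoint genfib_seq (A : nzRingType) (k n : nat) : seq {mpoly A[k]} :=
  match n with
  | 0 => [::]
  | 1 => [:: 1]
  | n'.+1 => let s := genfib_seq A k n' in
             (\sum_(j < k) tvar A k j.+1 * s`_j) :: s
  end.

(* genfib_le0, genfib1, genfib2 and genfib_rec below are the defining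
   equations. *)
Definition genfib (A : nzRingType) (k : nat) (m : int) : {mpoly A[k]} :=
  if m is Posz n then (genfib_seq A k n)`_0 else 0.

Definition ratfun (R : realType) (k : nat) : fieldType :=
  {fraction {mpoly R[i][k]}}.

Definition ratfun_poly (R : realType) (k : nat) (p : {mpoly R[i][k]}) :
  ratfun R k := FracField.tofrac p.

Definition ratfun_const (R : realType) (k : nat) (c : R[i]) : ratfun R k :=
  ratfun_poly c%:MP.

(* The row and column indices start at 0, which leaves r - s unchanged. *)
Definition hessenberg (R : realType) (k n : nat) : 'M[ratfun R k]_n :=
  let t j := ratfun_poly (tvar R[i] k j) in
  let im := ratfun_const k ('i%C : R[i]) in
  \matrix_(r < n, s < n)
    let d : int := r%:Z - s%:Z in
    if -1 <= d < k%:Z then im ^ d * (t `|(d + 1)%R|%N / t 2%N ^ d) else 0.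

Lemma tvarS (A : nzRingType) (k : nat) (j : 'I_k) : tvar A k j.+1 = 'X_j.
Proof. by rewrite /tvar valK. Qed.

Lemma nth_genfib_seq (A : nzRingType) (k n j : nat) :
  (genfib_seq A k n)`_j = genfib A k (n%:Z - j%:Z).
Proof.
elim: n j => [|n IH] [|j]; rewrite ?subr0 //.
have -> : n.+1%:Z - j.+1%:Z = n%:Z - j%:Z by rewrite !intS opprD addrACA subrr add0r.
by case: n IH => [|n] IH; rewrite -IH //= !nth_nil.
Qed.

Lemma genfib_le0 (A : nzRingType) (k : nat) (m : int) :
  m < 1 -> genfib A k m = 0.
Proof. by case: m => [[|n]|n]. Qed.

Lemma genfib1 (A : nzRingType) (k : nat) : genfib A k 1 = 1.
Proof. by []. Qed.

Lemma genfib_rec (A : nzRingType) (k : nat) (m : int) : 1 <= m ->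
  genfib A k (m + 1) = \sum_(j < k) 'X_j * genfib A k (m - j%:Z).
Proof.
case: m => [[|n]|n] // _; rewrite -PoszD addn1.
rewrite [LHS]/=; apply: eq_bigr => j _.
by rewrite -nth_genfib_seq -tvarS.
Qed.

Lemma genfib2 (A : nzRingType) (k : nat) :
  (0 < k)%N -> genfib A k 2 = tvar A k 1.
Proof.
case: k => // k _; rewrite (_ : 2 = 1 + 1) // genfib_rec // big_ord_recl.
rewrite subr0 genfib1 mulr1 big1 ?addr0 ?(tvarS A ord0) // => j _.
by rewrite genfib_le0 ?mulr0 // gtrDl oppr_lt0.
Qed.

(* Main.v *)
Require Import Defs.
From mathcomp Require Import all_boot all_order all_algebra.
From mathcomp Require Import fraction complex reals mpoly.
From mathcomp Require Import perm zify.

(** Conjugation by diag(c^r) with c = i/t_2 turns H_{k,n} into the Toeplitz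
    Hessenberg matrix with entries t_{r-s+1}, without changing the permanent.
    Its superdiagonal is 1, so expanding along the top row again and again
    gives the recurrence per T_{n+1} = sum_j t_{j+1} per T_{n-j}, which is the
    one defining F_{k,n+1}. *)

Set Implicit Arguments.
Unset Strict Implicit.
Unset Printing Implicit Defensive.

Import Order.TTheory GRing.Theory Num.Theory.
Local Open Scope ring_scope.

(** A permutation with [s i = j] maps the complement of [i] into that of [j]; reading this
    restriction through [lift] gives an injective [f], hence [s']. *)
Lemma lift_perm_surj (n : nat) (i j : 'I_n.+1) (s : 'S_n.+1) :
  s i = j -> exists s', lift_perm i j s' = s.
Proof.
move=> si.
have sE k : {l | s (lift i k) = lift j l}.
  case: (unliftP j (s (lift i k))) => [l ->|]; first by exists l.
  by rewrite -si => /perm_inj/eqP; rewrite eq_sym (negPf (neq_lift _ _)).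
pose f k := sval (sE k).
have fE k : s (lift i k) = lift j (f k) := svalP (sE k).
have inj : injective f.
  by move=> k l fkl; apply: (@lift_inj _ i); apply: (@perm_inj _ s); rewrite !fE fkl.
exists (perm inj); apply/permP => k; case: (unliftP i k) => [l|] ->.
  by rewrite lift_perm_lift permE fE.
by rewrite lift_perm_id si.
Qed.

Lemma lift_perm_inj (n : nat) (i j : 'I_n.+1) : injective (@lift_perm n i j).
Proof.
move=> s t st; apply/permP => k; apply: (@lift_inj _ j).
by rewrite -!(lift_perm_lift i) st.
Qed.

Lemma permanent_lift_perm (A : comNzRingType) (n : nat) (M : 'M[A]_n.+1) i j :
  \sum_(s : 'S_n.+1 | s i == j) \prod_(r | i != r) M r (s r)
    = permanent (row' i (col' j M)).
Proof.
(* [lift_perm i j] is a bijection onto the permutations sending [i] to [j]; its partial inverse is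
   given by choice. *)
rewrite (reindex_omap (lift_perm i j)
  (fun s => [pick s' | lift_perm i j s' == s])) /=; last first.
  move=> s /eqP /lift_perm_surj[s' ss']; case: pickP => [t /eqP /= -> //|/(_ s')].
  by rewrite ss' eqxx.
rewrite (eq_bigl predT) => [|s]; last first.
  rewrite lift_perm_id eqxx; case: pickP => [t /eqP/lift_perm_inj -> | /(_ s)].
    by rewrite eqxx.
  by rewrite eqxx.
apply: eq_bigr => s _.
rewrite (reindex_omap (lift i) (unlift i)) /=; last first.
  by move=> r; case: unliftP => //= [r' ->|->]; rewrite ?eqxx.
by apply: eq_big => [r|r _]; rewrite ?liftK ?neq_lift ?eqxx // lift_perm_lift !mxE.
Qed.

(** Laplace expansion without signs: group the permutations by the image of [i]. *)
Lemma expand_permanent_row (A : comNzRingType) (n : nat) (M : 'M[A]_n.+1) i :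
  permanent M = \sum_j M i j * permanent (row' i (col' j M)).
Proof.
rewrite /permanent (partition_big (fun s : 'S_n.+1 => s i) predT) //=.
apply: eq_bigr => j _; rewrite -/(permanent _) -permanent_lift_perm big_distrr.
apply: eq_bigr => s /eqP si; rewrite (bigD1 i) //= si; congr (_ * _).
by apply: eq_bigl => r; rewrite eq_sym.
Qed.

Lemma permanent0 (A : comNzRingType) (M : 'M[A]_0) : permanent M = 1.
Proof.
rewrite /permanent (eq_bigr (fun=> 1)) => [|s _]; last by rewrite big_ord0.
by rewrite sumr_const card_Sn.
Qed.

(** In each term the extra factor is the product of [c ^ (r - s r)] over [r], which is 1 because [s]
    permutes the indices. *)
Lemma permanent_conj_diag (K : fieldType) (n : nat) (c : K) (M N : 'M[K]_n) :
  c != 0 -> (forall r s, M r s = c ^ (r%:Z - s%:Z) * N r s) ->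
  permanent M = permanent N.
Proof.
move=> c0 MN; apply: eq_bigr => s _.
rewrite (eq_bigr _ (fun r _ => MN r (s r))) big_split /=.
rewrite (eq_bigr (fun r : 'I_n => c ^+ r / c ^+ s r)) => [|r _]; last first.
  by rewrite expfzDr // exprnN.
rewrite big_split /= prodfV (reindex_perm s) /= mulfV ?mul1r //.
by apply/prodf_neq0 => r _; rewrite expf_neq0.
Qed.

(** The index is shifted by one so that [a 0] sits on the superdiagonal. *)
Definition toeplitz (A : nzRingType) (a : nat -> A) (r s : nat) : A :=
  if (s <= r.+1)%N then a (r.+1 - s)%N else 0.

Definition toeplitz_mx (A : nzRingType) (a : nat -> A) (n : nat) : 'M[A]_n :=
  \matrix_(r, s) toeplitz a r s.

(* Deleting row 0 and column 1 keeps the Toeplitz part and shifts the first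
   column; the free first column makes the family closed under this step. *)
Definition bordered_toeplitz_mx (A : nzRingType) (a b : nat -> A) (n : nat) :
    'M[A]_n :=
  \matrix_(r, s) if s == 0 :> nat then b r else toeplitz a r s.

Lemma permanent_bordered_toeplitz (A : comNzRingType) (a b : nat -> A) n :
  a 0%N = 1 ->
  permanent (bordered_toeplitz_mx a b n.+1)
    = \sum_(j < n.+1) b j * permanent (toeplitz_mx a (n - j)).
Proof.
move=> a0; elim: n b => [|n IH] b.
  rewrite (expand_permanent_row _ ord0) !big_ord1 !mxE /=.
  by rewrite !permanent0.
(* Row 0 is [b 0], [a 0 = 1], then zeros. The minor of [b 0] is plain Toeplitz; that of [a 0] is
   bordered again, with [b] shifted by one, so the induction is over all [b]. *)
rewrite (expand_permanent_row _ ord0) big_ord_recl [RHS]big_ord_recl.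
congr (_ + _).
  by rewrite !mxE; congr (_ * permanent _); apply/matrixP => r s; rewrite !mxE.
rewrite big_ord_recl big1 ?addr0 => [|j _]; last by rewrite !mxE /= mul0r.
rewrite !mxE /= {1}/toeplitz /= a0 mul1r -(IH (fun j => b j.+1)).
congr permanent; apply/matrixP => r s; rewrite !mxE /= /bump /=.
by case: s => [[|s] Hs].
Qed.

Lemma permanent_toeplitz_rec (A : comNzRingType) (a : nat -> A) n :
  a 0%N = 1 ->
  permanent (toeplitz_mx a n.+1)
    = \sum_(j < n.+1) a j.+1 * permanent (toeplitz_mx a (n - j)).
Proof.
move=> a0; rewrite -(permanent_bordered_toeplitz (fun j => a j.+1)) //.
by congr permanent; apply/matrixP => r [[|s] Hs]; rewrite !mxE //=.
Qed.

(** Conjugation with ratio [x / y]. The cutoff at [k] agrees with the Toeplitz entries since [a]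
    vanishes beyond [k]. *)
Lemma permanent_scaled_hessenberg (K : fieldType) (x y : K) (a : nat -> K)
    (k n : nat) :
  x != 0 -> y != 0 -> (forall j, (k < j)%N -> a j = 0) ->
  permanent (\matrix_(r < n, s < n)
    let d : int := r%:Z - s%:Z in
    if -1 <= d < k%:Z then x ^ d * (a `|(d + 1)%R|%N / y ^ d) else 0)
  = permanent (toeplitz_mx a n).
Proof.
move=> x0 y0 a_gt; have c0 : x / y != 0 by rewrite mulf_neq0 ?invr_eq0.
apply: (permanent_conj_diag c0) => r s; rewrite !mxE /toeplitz /=.
case: leqP => sr; last by rewrite ifN ?mulr0 //; lia.
have -> : `|(r%:Z - s%:Z + 1)%R|%N = (r.+1 - s)%N by lia.
have -> /= : -1 <= r%:Z - s%:Z by lia.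
case: ltP => dk; first by rewrite expfzMl -expfV mulrA mulrAC.
by rewrite a_gt ?mulr0 //; lia.
Qed.

Lemma tvar_gt (A : nzRingType) (k j : nat) : (k < j)%N -> tvar A k j = 0.
Proof. by case: j => // j kj; rewrite /tvar insubN // -leqNgt. Qed.

(** The defining sum has [k] terms, this one [n.+1]. Extended to a common range, they agree: the
    surplus terms vanish, by [genfib_le0] for [j > n] and by [tvar_gt] for [j >= k]. *)
Lemma genfib_recS (A : nzRingType) (k n : nat) :
  genfib A k n.+2%:Z
    = \sum_(j < n.+1) tvar A k j.+1 * genfib A k (n - j).+1%:Z.
Proof.
have -> : n.+2%:Z = n.+1%:Z + 1 by rewrite -PoszD addn1.
rewrite genfib_rec //.
under eq_bigr => j _ do rewrite -tvarS.
rewrite (big_ord_widen (k + n.+1)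
  (fun j => tvar A k j.+1 * genfib A k (n.+1%:Z - j%:Z))) ?leq_addr //.
rewrite [RHS](big_ord_widen (k + n.+1)
  (fun j => tvar A k j.+1 * genfib A k (n - j).+1%:Z)) ?leq_addl //.
rewrite big_mkcond [RHS]big_mkcond; apply: eq_bigr => j _ /=.
case: ltnP => [jk|kj]; case: ltnP => [jn|nj] //.
- by rewrite subzn ?(ltnW jn) // subSn.
- by rewrite genfib_le0 ?mulr0 // (le_lt_trans _ ltr01) // subr_le0.
- by rewrite -/(tvar A k j.+1) tvar_gt ?mul0r.
Qed.

Lemma genfib_permanent_toeplitz (A : comNzRingType) (k n : nat) :
  permanent (toeplitz_mx (tvar A k) n) = genfib A k n.+1%:Z.
Proof.
elim/ltn_ind: n => [[|n]] IH; first by rewrite permanent0.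
rewrite permanent_toeplitz_rec // genfib_recS.
by apply: eq_bigr => j _; rewrite IH // ltnS leq_subr.
Qed.

Theorem theorem3p2 (R : realType) (k n : nat) (hk : (2 <= k)%N)
    (hn : (1 <= n)%N) :
  permanent (hessenberg R k n) = ratfun_poly (genfib R[i] k (n%:Z + 1)).
Proof.
rewrite -PoszD addn1 -genfib_permanent_toeplitz.
(* As [2 <= k], t_2 is a genuine indeterminate, of index 1, and not the dummy 0. *)
have t2 : ratfun_poly (tvar R[i] k 2) != 0.
  by rewrite /ratfun_poly tofrac_eq0 (tvarS _ (Ordinal hk)) -msupp_eq0 msuppX.
have i0 : ratfun_const k ('i%C : R[i]) != 0.
  by rewrite /ratfun_const /ratfun_poly tofrac_eq0 mpolyC_eq0 complexiE neq0Ci.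
have t_gt j : (k < j)%N -> ratfun_poly (tvar R[i] k j) = 0.
  by move=> kj; rewrite tvar_gt // /ratfun_poly tofrac0.
rewrite /hessenberg (permanent_scaled_hessenberg n i0 t2 t_gt).
(* The embedding of polynomials into fractions is a ring morphism, so it commutes with the
   permanent. *)
rewrite /ratfun_poly /permanent rmorph_sum.
apply: eq_bigr => s _; rewrite rmorph_prod; apply: eq_bigr => r _.
by rewrite !mxE /toeplitz; case: ifP => // _; rewrite tofrac0.
Qed.
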